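(* Let $A=\{-1,0,1\}$ with addition modulo $3$. Every binary three numbers function (possibly single-valued, many-valued or no-valued at each point) can be represented as a superposition of three numbers functions of one variable. That is, for every $H:A^2\to\mathcal{P}(A)$ there exist a positive integer $L$ and unary three numbers functions $f_i,g_{i1},g_{i2}:A\to\mathcal{P}(A)$, $1\le i\le L$, such that for all $(x_1,x_2)\in A^2$ $$H(x_1,x_2)=\sum_{i=1}^{L} f_i\big[g_{i1}(x_1)+g_{i2}(x_2)\big].$$
   Context: $A=\{-1,0,1\}$ is equipped with addition modulo $3$ (so $1+1=-1$ and $(-1)+(-1)=1$). A three numbers function of $M$ variables assigns to each point of $A^M$ a set of values in $A$: one value (single-valued at that point), two or three values (many-valued there), or no value (no-valued there). Thus it is a map $A^M\to\mathcal{P}(A)$, where $\mathcal{P}(A)$ is the power set of $A$; there are $8^9$ binary ($M=2$) and $8^3$ unary ($M=1$) three numbers functions. Single-valued functions are identified with ordinary maps $A^M\to A$. Conventions for combining values: for $S,T\subseteq A$, $S+T=\{s+t: s\in S,\ t\in T\}$ (so the sum is empty if either set is empty). For a unary function $f$ and $S\subseteq A$, $f[S]=\bigcup_{s\in S}f(s)$. Sums of functions are taken pointwise, and equality of functions means equality of value sets at every point. A binary function is said to be represented as a superposition of functions of one variable when it is written in the form $\sum_{i=1}^L f_i[g_{i1}(x_1)+g_{i2}(x_2)]$ with all $f_i,g_{ij}$ unary. *)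

(* Defs.v *)
From HB Require Import structures.
From mathcomp Require Import all_boot all_order all_algebra.
Set Implicit Arguments.
Unset Strict Implicit.
Unset Printing Implicit Defensive.
Import GRing.Theory.
Local Open Scope ring_scope.

(* {-1, 0, 1} with addition modulo 3; -1 is represented by 2. *)
Notation A3 := 'Z_3.

(* A value set may be empty ("no value"), a singleton, or larger. *)
Definition unary3 : Type := A3 -> {set A3}.
Definition binary3 : Type := A3 -> A3 -> {set A3}.

Definition vadd (S T : {set A3}) : {set A3} := [set s + t | s in S, t in T].

Definition vapp (f : unary3) (S : {set A3}) : {set A3} := \bigcup_(s in S) f s.

(* [set 0] is neutral for vadd, so for L > 0 this is the L-fold sum of the F i;
   set0 would instead be absorbing. *)
Definition vsum (L : nat) (F : 'I_L -> {set A3}) : {set A3} :=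
  \big[vadd/[set 0]]_(i < L) F i.

(* Main.v *)
(* With g1 the indicator of a and g2 the indicator of b, g1 + g2 equals 2 exactly
   at (a, b), so a single term takes any prescribed value set at (a, b) and is
   {0} elsewhere. H is the sum of nine such terms. *)
Require Import Defs.
From HB Require Import structures.
From mathcomp Require Import all_boot all_order all_algebra.
Set Implicit Arguments.
Unset Strict Implicit.
Unset Printing Implicit Defensive.

Import GRing.Theory.

Lemma vaddC : commutative vadd.
Proof.
move=> S T; apply/setP=> z.
by apply/imset2P/imset2P=> -[s t sS tT ->]; exists t s; rewrite // addrC.
Qed.

Lemma vaddA : associative vadd.
Proof.
move=> S T U; apply/setP=> z; apply/imset2P/imset2P.
  move=> [s _ sS /imset2P[t u tT uU ->] ->].
  by exists (s + t)%R u; rewrite ?addrA ?imset2_f.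
move=> [_ u /imset2P[s t sS tT ->] uU ->].
by exists s (t + u)%R; rewrite ?addrA ?imset2_f.
Qed.

Lemma vadd0s : left_id [set 0%R] vadd.
Proof.
move=> S; apply/setP=> z; apply/imset2P/idP.
  by move=> [_ t /set1P-> tS ->]; rewrite add0r.
by move=> zS; exists 0%R z; rewrite ?set11 ?add0r.
Qed.

(** Lets the generic lemmas on iterated operators, such as splitting off one term, apply to
    [vsum]. *)
HB.instance Definition _ :=
  Monoid.isComLaw.Build {set A3} [set 0%R] vadd vaddA vaddC vadd0s.

Lemma vadd11 (s t : A3) : vadd [set s] [set t] = [set (s + t)%R].
Proof. by rewrite /vadd imset2_set1l imset_set1. Qed.

Lemma vapp1 (f : unary3) (s : A3) : vapp f [set s] = f s.
Proof. exact: big_set1. Qed.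

Definition indicator (a : A3) : unary3 := fun x => [set ((x == a)%:R)%R].

Definition value_at2 (S : {set A3}) : unary3 :=
  fun z => if z == 2%:R%R then S else [set 0%R].

(** Two bits add up to 0, 1 or 2 with no wrap-around modulo 3, so the value 2 forces both to be
    1. *)
Lemma vapp_value_at2 (S : {set A3}) (a b x y : A3) :
  vapp (value_at2 S) (vadd (indicator a x) (indicator b y)) =
  if (a, b) == (x, y) then S else [set 0%R].
Proof.
rewrite vadd11 vapp1 /value_at2 xpair_eqE (eq_sym a) (eq_sym b).
by case: (x == a); case: (y == b).
Qed.

Theorem theorem2p1 (H : binary3) :
  exists (L : nat) (f g1 g2 : 'I_L -> unary3),
    (0 < L)%N /\
    forall x1 x2 : A3,
      H x1 x2 = vsum (fun i : 'I_L => vapp (f i) (vadd (g1 i x1) (g2 i x2))).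
Proof.
(* One term per point of the plane: [p i] is the point that term [i] controls. *)
pose p (i : 'I_#|{: A3 * A3}|) : A3 * A3 := enum_val i.
exists #|{: A3 * A3}|, (fun i => value_at2 (H (p i).1 (p i).2)),
  (fun i => indicator (p i).1), (fun i => indicator (p i).2).
split=> [|x y]; first by rewrite card_prod card_ord.
(* Isolates the term controlling [(x, y)]; all others are the neutral [[set 0]]. *)
rewrite /vsum (bigD1 (enum_rank (x, y))) //= big1 => [|i].
  by rewrite vapp_value_at2 /p enum_rankK eqxx Monoid.mulm1.
rewrite vapp_value_at2 -surjective_pairing /p => neq_i.
(* [neq_i] compares indices, the goal compares points; [enum_rank] translates. *)
by rewrite -(inj_eq enum_rank_inj) enum_valK (negPf neq_i).
Qed.
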